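(* Let $T$ be a finite non-abelian simple group, let $k\ge 2$, let $X\le \mathrm{Out}(T)\times S_k$, and let $G=T^k.X\le D(k,T)$ be a primitive permutation group of simple diagonal type. Let $t\in T\setminus\{1\}$ and let $\Gamma_0^t$ be the orbital graph of $G$ with vertex set the set of right cosets of $D_A$ in $G$ and edge set $\{D_A, D_A(1,\dots,1,t)\}^G$. Then $$\tfrac12 (k-1)\,c_{X_0}(T,t)+1\;\le\; \mathrm{diam}(\Gamma_0^t)\;\le\;(k-1)\,c_i(T).$$
   Context: Simple diagonal groups. $T$ is a finite non-abelian simple group, identified with $\mathrm{Inn}(T)\le \mathrm{Aut}(T)$. Define $D(k,T)=\{(\tau_1,\dots,\tau_k).\pi : \tau_i\in \mathrm{Aut}(T),\ \pi\in S_k,\ \text{all } \tau_i \text{ lie in the same } \mathrm{Inn}(T)\text{-coset}\}\le \mathrm{Aut}(T)\,\mathrm{wr}\,S_k$; it contains $T^k$ as a normal subgroup with $D(k,T)/T^k\cong \mathrm{Out}(T)\times S_k$. For $X\le \mathrm{Out}(T)\times S_k$, $G=T^k.X$ denotes the preimage of $X$ in $D(k,T)$. Let $W=\{(\alpha,\dots,\alpha).\pi : \alpha\in \mathrm{Aut}(T),\pi\in S_k\}$ and $D_A=W\cap G$. Then $G=D_AT^k$, and $G$ acts by right multiplication on the set $\Omega=(G:D_A)$ of right cosets of $D_A$ in $G$; $G$ is a primitive group of simple diagonal type if this action is primitive. The group $X_0$. Let $\rho:X\to \mathrm{Out}(T)$ be the projection and $\pi:\mathrm{Aut}(T)\to \mathrm{Out}(T)$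 the canonical map. Put $X_0=\pi^{-1}(\rho(X))\le \mathrm{Aut}(T)$. Widths. For a generating set $S$ of $T$, $w_S(T)$ is the minimal $m\in\mathbb N$ such that every element of $T$ is a product of at most $m$ elements of $S$. For $T\unlhd Y\le \mathrm{Aut}(T)$ and $t\in T\setminus\{1\}$, put $t^{\pm Y}=\{(t^{\alpha})^{\pm1}:\alpha\in Y\}$ and $c_Y(T,t)=w_{t^{\pm Y}}(T)$. For $Y=\mathrm{Inn}(T)$, i.e. $t^{\pm T}=t^T\cup (t^{-1})^T$, write $c_i(T,t)=w_{t^{\pm T}}(T)$ and $c_i(T)=\max_{t\in T\setminus\{1\}}c_i(T,t)$. Graphs. The notation $\{a,b\}^G$ for the edge set means the set of all images of the unordered pair $\{a,b\}$ under $G$ (an undirected graph). *)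

(* Defs.v *)
From HB Require Import structures.
From mathcomp Require Import all_boot all_order all_algebra.
From mathcomp Require Import all_fingroup all_solvable.

Set Implicit Arguments.
Unset Strict Implicit.
Unset Printing Implicit Defensive.

Local Open Scope group_scope.

(* A wr S_k.  Everything acts on the right: in S_k, i (s * t) = (i s) t, and the
   conjugate s^-1 (a_1, ..., a_k) s has i-th entry a_(i s^-1), whence the product
   of a.s and b.t has base part a * (s b s^-1) = (a_i * b_(i s))_i. *)
Record wreath (k : nat) (A : Type) :=
  Wreath { wbase : {ffun 'I_k -> A}; wperm : 'S_k }.

Section Wreath.
Variables (k : nat) (A : finGroupType).
Implicit Types u v w : wreath k A.

Definition wreath_pair w := (wbase w, wperm w).
Definition pair_wreath (p : {ffun 'I_k -> A} * 'S_k) := Wreath p.1 p.2.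
Lemma wreath_pairK : cancel wreath_pair pair_wreath. Proof. by case. Qed.

HB.instance Definition _ := Finite.copy (wreath k A) (can_type wreath_pairK).

Definition wreath_one : wreath k A := Wreath [ffun=> 1] 1.
Definition wreath_mul u v : wreath k A :=
  Wreath [ffun i => wbase u i * wbase v (wperm u i)] (wperm u * wperm v).
Definition wreath_inv u : wreath k A :=
  Wreath [ffun i => (wbase u ((wperm u)^-1 i))^-1] (wperm u)^-1.

Lemma wreath_mulA : associative wreath_mul.
Proof.
move=> u v w; congr Wreath; last exact: mulgA.
by apply/ffunP=> i; rewrite !ffunE /= permM mulgA.
Qed.

Lemma wreath_mul1 : left_id wreath_one wreath_mul.
Proof.
case=> a s; congr Wreath; last exact: mul1g.
by apply/ffunP=> i; rewrite !ffunE /= perm1 mul1g.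
Qed.

Lemma wreath_mulV : left_inverse wreath_one wreath_inv wreath_mul.
Proof.
case=> a s; congr Wreath; last exact: mulVg.
by apply/ffunP=> i; rewrite !ffunE /= mulVg.
Qed.

HB.instance Definition _ :=
  Finite_isGroup.Build (wreath k A) wreath_mulA wreath_mul1 wreath_mulV.

End Wreath.

Section DiagonalGroups.
Variables (gT : finGroupType) (T : {group gT}).

Definition Inn := conj_aut T @* T.
Canonical Inn_group := [group of Inn].
Definition Out := Aut T / Inn.

Lemma Inn_sub_Aut : Inn \subset Aut T.
Proof. exact: Aut_conj_aut. Qed.

Lemma Inn_normal : Inn <| Aut T.
Proof.
rewrite /normal Inn_sub_Aut; apply/subsetP=> a Aa.
rewrite inE; apply/subsetP=> _ /imsetP[_ /morphimP[x _ Tx ->] ->].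
have Tax: a x \in T by rewrite Aut_closed.
suff ->: conj_aut T x ^ a = conj_aut T (a x).
  by rewrite mem_morphim // (subsetP (normG T)).
have Ac y : y \in T -> conj_aut T y \in Aut T.
  by move=> Ty; apply: (subsetP Inn_sub_Aut); rewrite mem_morphim // (subsetP (normG T)).
apply: (eq_Aut (A := T)); rewrite ?groupJ ?Ac // => y Ty.
have Ta'y : a^-1 y \in T by rewrite Aut_closed ?groupV.
rewrite conjgE !permM !conj_autE // -[in LHS](autmE Aa) morphJ //= autmE.
by rewrite permKV.
Qed.

Variable k : nat.

(* D(k,T) *)
Definition diag_full : {set wreath k {perm gT}} :=
  [set w | [forall i, wbase w i \in Aut T] &&
           [forall i, forall j, Inn :* wbase w i == Inn :* wbase w j]].

(* T^k.X: since all entries of an element of D(k,T) have the same image in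
   Out(T), its image in Out(T) x S_k may be read off from any of them. *)
Definition diag_ext (X : {set coset_of Inn * 'S_k}) : {set wreath k {perm gT}} :=
  [set w in diag_full | [forall i, (coset Inn (wbase w i), wperm w) \in X]].

Definition diag_W : {set wreath k {perm gT}} :=
  [set w | [exists a in Aut T, wbase w == [ffun=> a]]].

(* D_A *)
Definition diag_stab (X : {set coset_of Inn * 'S_k}) := diag_W :&: diag_ext X.

(* (1, ..., 1, t), with t identified with the inner automorphism it induces *)
Definition last_elt (t : gT) : wreath k {perm gT} :=
  Wreath [ffun i : 'I_k => if i.+1 == k then conj_aut T t else 1] 1.

(* X_0 *)
Definition diag_X0 (X : {set coset_of Inn * 'S_k}) : {set {perm gT}} :=
  [set a in Aut T | coset Inn a \in [set x.1 | x in X]].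

Definition diag_vertices X := rcosets (diag_stab X) (diag_ext X).

Definition orbital_adj X (t : gT) : rel {set wreath k {perm gT}} :=
  fun A B => [set A; B] \in
    orbit ('Rs^*) (diag_ext X) [set diag_stab X; diag_stab X :* last_elt t].

Lemma group_set_diag_ext (X : {group coset_of Inn * 'S_k}) :
  group_set (diag_ext X).
Proof.
have nIA := normal_norm Inn_normal.
have DP w : reflect [/\ forall i, wbase w i \in Aut T,
    forall i j, coset Inn (wbase w i) = coset Inn (wbase w j) &
    forall i, (coset Inn (wbase w i), wperm w) \in X] (w \in diag_ext X).
  have E i j : wbase w i \in Aut T -> wbase w j \in Aut T ->
    (Inn :* wbase w i == Inn :* wbase w j) =
      (coset Inn (wbase w i) == coset Inn (wbase w j)).
    move=> /(subsetP nIA) Ni /(subsetP nIA) Nj; apply/eqP/eqP=> [/rcoset_eqP|] eq_ij.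
      by apply/rcoset_kercosetP.
    by apply/rcoset_eqP/rcoset_kercosetP.
  rewrite !inE; apply: (iffP andP) => [[/andP[/forallP A /forallP C] /forallP Y]|[A C Y]].
    by split=> // i j; apply/eqP; rewrite -E //; apply: (forallP (C i)).
  split; last exact/forallP.
  apply/andP; split; first exact/forallP.
  by apply/forallP=> i; apply/forallP=> j; rewrite E // (C i j).
apply/group_setP; split.
  apply/DP; split=> [i|i j|i]; rewrite /= !ffunE ?group1 //.
  by rewrite morph1 (group1 X).
move=> u v /DP[Au Cu Xu] /DP[Av Cv Xv]; apply/DP.
have cM a b : a \in Aut T -> b \in Aut T ->
    coset Inn (a * b) = coset Inn a * coset Inn b.
  by move=> Aa Ab; rewrite morphM ?(subsetP nIA).
split=> [i|i j|i]; rewrite /= !ffunE ?groupM // !cM //.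
  by rewrite (Cu i j) (Cv _ (wperm u j)).
exact: (groupM (Xu i) (Xv (wperm u i))).
Qed.

Canonical diag_ext_group X := Group (group_set_diag_ext X).

End DiagonalGroups.

Section Width.
Variable gT : finGroupType.
Implicit Types S Y : {set gT}.

Definition prod_le S Y m := Y \subset \bigcup_(j < m.+1) S ^+ j.

Lemma width_exists S Y : exists m, (Y \subset <<S>>) ==> prod_le S Y m.
Proof.
have [n def] := gen_expgs S; exists n; apply/implyP; rewrite def => sYS.
apply: subset_trans sYS _; apply/subsetP; elim: n {def} => [|n IHn] x.
  by rewrite expg0 => x1; apply/bigcupP; exists ord0.
rewrite expgS => /mulsgP[y z /setU1P Sy /IHn/bigcupP[j _ zj] ->].
case: Sy => [-> | Sy]; apply/bigcupP.
  by exists (widen_ord (leqnSn _) j); rewrite // mul1g.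
by exists (lift ord0 j); rewrite // lift0 expgS mem_mulg.
Qed.

(* w_S(Y); the value is 0 when S does not generate Y. *)
Definition width S Y : nat := ex_minn (width_exists S Y).

Lemma widthP S Y : <<S>> = Y ->
  prod_le S Y (width S Y) /\ forall m, prod_le S Y m -> width S Y <= m.
Proof.
move=> genS; rewrite /width; case: ex_minnP => m.
rewrite {1}genS subxx => mP mmin; split=> // n nP; apply: mmin.
by rewrite nP implybT.
Qed.

End Width.

Section ClassWidth.
Variables (gT : finGroupType) (T : {group gT}).

(* t^{+-Y} and c_Y(T,t) *)
Definition pm_class (Y : {set {perm gT}}) (t : gT) : {set gT} :=
  [set a t | a : {perm gT} in Y] :|: [set (a t)^-1 | a : {perm gT} in Y].

Definition class_width Y t := width (pm_class Y t) T.

(* c_i(T) *)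
Definition inner_width := \max_(t in T^#) class_width (Inn T) t.

End ClassWidth.

Section Diameter.
Variables (V : finType) (vs : {set V}) (e : rel V).

Definition is_dist (x y : V) (n : nat) :=
  (exists p, [/\ path e x p, last x p = y & size p = n]) /\
  forall p, path e x p -> last x p = y -> n <= size p.

(* d is the diameter of the graph with vertex set vs and adjacency e, which is
   thereby asserted to be connected. *)
Definition is_diameter (d : nat) :=
  (forall x y, x \in vs -> y \in vs -> exists2 n, is_dist x y n & n <= d) /\
  exists x y, [/\ x \in vs, y \in vs & is_dist x y d].

End Diameter.

(* Main.v *)
Require Import Defs.
From mathcomp Require Import all_boot all_order all_algebra.
From mathcomp Require Import all_fingroup all_solvable.
From mathcomp Require Import zify lra.
Import GRing.Theory Num.Theory.

Set Implicit Arguments.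
Unset Strict Implicit.
Unset Printing Implicit Defensive.

(** Write D for the point stabiliser D_A and tau for (1, ..., 1, t).  Every vertex
    is D z with z in G, and the neighbours of D g are the cosets D u g where u is a
    D-conjugate of tau or of its inverse (coset_adjP).  The distance from D to
    D w is thus the least n such that D w contains a word of length n in these
    conjugates.  Conjugating by (a, ..., a).s moves the entry t to
    coordinate (k)s and applies a to it (wsingle_conj), so each letter of a word has
    a single nontrivial entry, which lies in the set S of images of t and t^-1
    under X_0.

    Upper bound.  The coordinates that D can carry the last one to are reachable.
    Two distinct unreachable coordinates would yield a subgroup strictly between D
    and G, consisting of the elements whose entries at unreachable coordinates all
    agree; primitivity forbids this (unreachable_unique).  Each vertex D w has a
    representative in T^k that is trivial at a coordinate of our choice; with the
    unreachable one chosen, if there is one, each of the other k - 1 entries is a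
    product of at most c_i(T) letters available at that coordinate
    (word_length_upper_bound).

    Lower bound.  A word of length n in the coset of (e_1, ..., e_k) has entries x_i
    which are products of f_i letters of S, with f_1 + ... + f_k = n, and lying in
    the same diagonal coset means that e_i^-1 e_j = x_i^-1 x_j is a product of
    f_i + f_j letters.  Let g be an element of S-length c = c_(X_0)(T,t) and
    m = floor(k/2), and take m entries equal to 1 and m equal to g.  Pairing them
    off gives n >= m c, which suffices for even k because c >= 2: if c were 1, all
    nontrivial elements of T would have the order of t and T would be a p-group.
    For odd k the remaining entry h is a conjugate of g other than g.  Either
    it costs one more letter, or its x_i is 1; in the latter case each pair costs
    at least length(h) + length(h^-1 g) >= c + 1 (word_length_lower_bound). *)

(** * Diameters of finite graphs *)

Section FiniteGraphs.
Variables (V : finType) (vs : {set V}) (e : rel V).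

(** The diameter is taken as the largest distance attained; the uniform bound N on
    the lengths of connecting paths makes it exist. *)
Lemma bounded_diameter (x0 : V) N :
    x0 \in vs ->
    (forall x y, x \in vs -> y \in vs ->
       exists p, [/\ path e x p, last x p = y & size p <= N]) ->
  exists2 d, is_diameter vs e d & d <= N.
Proof.
move=> vs_x0 conn.
pose joined x y n := [exists p : n.-tuple V, path e x p && (last x p == y)].
have joinedP x y n :
  reflect (exists p, [/\ path e x p, last x p = y & size p = n]) (joined x y n).
  apply: (iffP existsP) => [[p /andP[ep /eqP lp]] | [p [ep lp sz]]].
    by exists p; rewrite size_tuple.
  have szP : size p == n by apply/eqP.
  by exists (Tuple szP); rewrite /= ep lp eqxx.
pose dist x y n := joined x y n && [forall j : 'I_n, ~~ joined x y j].
have distP x y n : dist x y n -> is_dist e x y n.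
  case/andP=> /joinedP xy_n /forallP min_n; split=> // p ep lp.
  rewrite leqNgt; apply/negP=> lt_p; case/negP: (min_n (Ordinal lt_p)).
  by apply/joinedP; exists p.
have exdist x y : x \in vs -> y \in vs -> exists2 n, dist x y n & n <= N.
  move=> vx vy; have [p [ep lp szp]] := conn x y vx vy.
  have ex_n : exists n, joined x y n by exists (size p); apply/joinedP; exists p.
  case: (ex_minnP ex_n) => n xy_n min_n; exists n; last first.
    by apply: leq_trans szp; apply: min_n; apply/joinedP; exists p.
  rewrite /dist xy_n; apply/forallP=> j; apply/negP=> /min_n.
  by rewrite leqNgt ltn_ord.
pose attained n := [exists x in vs, exists y in vs, dist x y n && (n <= N)].
have ex_d : exists n, attained n.
  have [n dn leN] := exdist x0 x0 vs_x0 vs_x0.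
  by exists n; apply/exists_inP; exists x0 => //; apply/exists_inP; exists x0;
    rewrite ?dn.
have le_d n : attained n -> n <= N.
  by case/exists_inP=> x _ /exists_inP[y _ /andP[]].
case: (ex_maxnP ex_d le_d) => d att_d max_d; exists d; last exact: le_d.
split=> [x y vx vy | ].
  have [n dn leN] := exdist x y vx vy; exists n; first exact: distP.
  by apply: max_d; apply/exists_inP; exists x => //; apply/exists_inP; exists y;
    rewrite ?dn.
have [x vx /exists_inP[y vy /andP[/distP d_xy _]]] := exists_inP att_d.
by exists x, y.
Qed.

End FiniteGraphs.

Lemma eq_set2 (V : finType) (a b c d : V) :
  [set a; b] = [set c; d] -> a = c /\ b = d \/ a = d /\ b = c.
Proof.
move=> eq_ab.
have: a \in [set c; d] by rewrite -eq_ab set21.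
have: b \in [set c; d] by rewrite -eq_ab set22.
have: c \in [set a; b] by rewrite eq_ab set21.
have: d \in [set a; b] by rewrite eq_ab set22.
by move=> /set2P[] ? /set2P[] ? /set2P[] ? /set2P[] ?; subst; auto.
Qed.

(** * Orbital graphs on cosets *)

Section CosetGraphs.
Local Open Scope group_scope.
Variables (gT : finGroupType) (D G : {group gT}) (tau : gT).
Hypotheses (sDG : D \subset G) (Gtau : tau \in G).

Definition coset_adj : rel {set gT} :=
  fun A B => [set A; B] \in orbit ('Rs^*) G [set gval D; D :* tau].

(** The elements u for which D is adjacent to D u, up to left multiplication
    by D. *)
Definition steps := tau ^: D :|: tau^-1 ^: D.

Lemma steps_sub : steps \subset G.
Proof.
apply/subsetP=> u /setUP[] /imsetP[d /(subsetP sDG) Gd ->];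
  by rewrite groupJ ?groupV.
Qed.

(** An edge at D g is the image of {D, D tau} under some h, with D g the image of
    either end.  If d h = g with d in D, the other end is D tau h = D (d tau d^-1) g;
    if d tau h = g, it is D h = D (d tau^-1 d^-1) g. *)
Lemma coset_adjP g B :
  g \in G -> reflect (exists2 u, u \in steps & B = D :* (u * g)) (coset_adj (D :* g) B).
Proof.
move=> Gg.
have rD h d : d \in D -> D :* (d * h) = D :* h.
  by move=> Dd; rewrite rcosetM rcoset_id.
have eqD h h' : D :* h = D :* h' -> exists2 d, d \in D & h' = d * h.
  by move/esym/rcoset_eqP/rcosetP.
apply: (iffP orbitP) => [[h Gh] | [u Su ->]].
  rewrite /= setactE imsetU1 imset_set1 /= !rcosetE -rcosetM.
  case/eq_set2=> [[eqDg <-] | [<- eqDg]]; have [d Dd ->] := eqD _ _ eqDg.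
    exists (tau ^ d^-1); first by rewrite inE memJ_class ?groupV.
    by rewrite conjgE invgK !mulgA mulgKV -mulgA [RHS]rD.
  exists (tau^-1 ^ d^-1); first by rewrite inE orbC memJ_class ?groupV.
  by rewrite conjgE invgK !mulgA mulgKV mulgKV rD.
case/setUP: Su => /imsetP[d Dd ->]; have Gd := subsetP sDG d Dd.
  exists (d * g); first exact: groupM Gd Gg.
  rewrite /= setactE imsetU1 imset_set1 /= !rcosetE -rcosetM.
  by rewrite conjgE -!mulgA (rD g d) // (rD _ d^-1) ?groupV.
exists (tau^-1 * d * g); first by rewrite !groupM ?groupV.
rewrite /= setactE imsetU1 imset_set1 /= !rcosetE -rcosetM setUC.
by rewrite conjgE -!mulgA mulKVg (rD _ d^-1) ?groupV // (rD g d).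
Qed.

Lemma coset_path_word g p :
    g \in G -> path coset_adj (D :* g) p ->
  exists2 z, z \in steps ^+ size p & last (D :* g) p = D :* (z * g).
Proof.
elim: p g => [|B p IH] g Gg /=.
  by exists 1; rewrite ?mul1g // expg0 set11.
case/andP=> /(coset_adjP _ Gg)[u Su ->].
case/IH=> [|z Sz ->]; first by rewrite groupM // (subsetP steps_sub).
by exists (z * u); rewrite ?mulgA // expgSr mem_mulg.
Qed.

Lemma coset_word_path n g z :
    g \in G -> z \in steps ^+ n ->
  exists p, [/\ path coset_adj (D :* g) p, last (D :* g) p = D :* (z * g) & size p = n].
Proof.
move=> Gg; elim: n z g Gg => [|n IH] z g Gg.
  by rewrite expg0 => /set1P->; exists [::]; rewrite mul1g.
rewrite expgSr => /mulsgP[z' u Sz' Su ->].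
have Gu : u \in G by rewrite (subsetP steps_sub).
have [p [ep lp szp]] := IH z' (u * g) (groupM Gu Gg) Sz'.
exists (D :* (u * g) :: p); rewrite /= ep lp szp mulgA; split=> //.
by rewrite andbT; apply/coset_adjP=> //; exists u.
Qed.

(** Right translation by g turns paths from D to D h g^-1 into paths from D g to
    D h, so only distances from D matter. *)
Lemma coset_diameter_le N :
    (forall g, g \in G ->
       exists n z, [/\ n <= N, z \in steps ^+ n & D :* z = D :* g]) ->
  exists2 d, is_diameter (rcosets D G) coset_adj d & d <= N.
Proof.
move=> reach; apply: (@bounded_diameter _ _ _ (D :* 1)).
  by apply/rcosetsP; exists 1.
move=> _ _ /rcosetsP[g Gg ->] /rcosetsP[h Gh ->].
have [n [z [leN Sz eqD]]] := reach (h * g^-1) (groupM Gh (groupVr Gg)).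
have [p [ep lp szp]] := coset_word_path Gg Sz.
by exists p; rewrite szp lp rcosetM eqD -rcosetM mulgKV.
Qed.

Lemma coset_word_le_diameter d g :
    is_diameter (rcosets D G) coset_adj d -> g \in G ->
  exists n z, [/\ n <= d, z \in steps ^+ n & D :* z = D :* g].
Proof.
case=> conn _ Gg; have [||n [[p [ep lp szp]] _] le_n] := conn (D :* 1) (D :* g).
- by apply/rcosetsP; exists 1.
- by apply/rcosetsP; exists g.
have [z Sz eqD] := coset_path_word (group1 G) ep.
by exists n, z; split; [| rewrite -szp | rewrite -lp eqD mulg1].
Qed.

End CosetGraphs.

(** * Widths of classes in simple groups *)

Section SetPowers.
Local Open Scope group_scope.
Variables (gT : finGroupType) (S : {set gT}).

Lemma mem_expgV n x : S^-1 = S -> x \in S ^+ n -> x^-1 \in S ^+ n.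
Proof. by move=> SV Sx; rewrite -mem_invg -expVgn SV. Qed.

Lemma mem_expgJ n x y : S :^ y = S -> x \in S ^+ n -> x ^ y \in S ^+ n.
Proof.
move=> SJ; elim: n x => [|n IH] x; first by rewrite !expg0 => /set1P->; rewrite conj1g set11.
rewrite !expgS => /mulsgP[a b Sa /IH Sb ->].
by rewrite conjMg mem_mulg // -SJ memJ_conjg.
Qed.

Lemma width_attained (Y : {set gT}) :
    <<S>> = Y -> 0 < width S Y ->
  exists2 g, g \in Y & forall j, g \in S ^+ j -> width S Y <= j.
Proof.
move=> genS w_gt0; have [_ min_w] := widthP genS.
have: ~~ prod_le S Y (width S Y).-1.
  by apply/negP=> /min_w; rewrite leqNgt prednK ?leqnn.
case/subsetPn=> g Yg; rewrite prednK // => not_g; exists g => // j Sj.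
rewrite leqNgt; apply/negP=> lt_j; case/bigcupP: not_g.
by exists (Ordinal lt_j).
Qed.

Lemma width_bound (Y : {set gT}) x :
  <<S>> = Y -> x \in Y -> exists2 j, j <= width S Y & x \in S ^+ j.
Proof.
move=> genS Yx; have [/subsetP/(_ x Yx)/bigcupP[j _ Sj] _] := widthP genS.
by exists j; rewrite // -ltnS.
Qed.

End SetPowers.

Section SimpleGroups.
Local Open Scope group_scope.
Variables (gT : finGroupType) (T : {group gT}).
Hypotheses (simT : simple T) (nabT : ~~ abelian T).

Lemma center_nonabelian_simple : 'Z(T) = 1.
Proof.
have [_ /(_ _ (center_normal T))[] // ZT] := simpleP _ simT.
by case/negP: nabT; apply/center_idP.
Qed.

Lemma moved_by_conj g : g \in T -> g != 1 -> exists2 y, y \in T & g ^ y != g.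
Proof.
move=> Tg ntg; case: (pickP [pred y in T | g ^ y != g]) => [y /andP[]|noy].
  by exists y.
suff: g \in 'Z(T) by rewrite center_nonabelian_simple => /set1P g1; rewrite g1 eqxx in ntg.
apply/centerP; split=> // y Ty; have := noy y; rewrite inE Ty /= => /negbFE/eqP gy.
by rewrite /commute -{2}gy -conjgC.
Qed.

Lemma conj_aut_inj : {in T &, injective (conj_aut T)}.
Proof.
have: 'injm (restrm (normG T) (conj_aut T)).
  by rewrite ker_restrm ker_conj_aut -center_nonabelian_simple.
by move/injmP.
Qed.

Lemma conj_autM : {in T &, {morph conj_aut T : x y / x * y}}.
Proof. by move=> x y Tx Ty; rewrite conj_aut_morphM ?(subsetP (normG T)). Qed.

Lemma conj_autV x : x \in T -> conj_aut T x^-1 = (conj_aut T x)^-1.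
Proof. by move=> Tx; rewrite morphV ?(subsetP (normG T)). Qed.

Lemma conj_aut_Inn x : x \in T -> conj_aut T x \in Inn T.
Proof. by move=> Tx; rewrite mem_morphim // (subsetP (normG T)). Qed.

Lemma conj_aut_Aut x : x \in T -> conj_aut T x \in Aut T.
Proof. by move/conj_aut_Inn; apply/subsetP/Inn_sub_Aut. Qed.

Lemma InnP a : reflect (exists2 x, x \in T & a = conj_aut T x) (a \in Inn T).
Proof.
apply: (iffP idP) => [/morphimP[x _ Tx ->] | [x Tx ->]]; first by exists x.
exact: conj_aut_Inn.
Qed.

Lemma aut_conjg a x y : a \in Aut T -> x \in T -> y \in T -> a (x ^ y) = a x ^ a y.
Proof. by move=> Aa Tx Ty; rewrite -!(autmE Aa) morphJ. Qed.

(** Under the identification of T with Inn T, conjugation by an automorphism a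
    becomes the application of a. *)
Lemma conj_aut_autJ a x :
  a \in Aut T -> x \in T -> conj_aut T x ^ a = conj_aut T (a x).
Proof.
move=> Aa Tx; have Tax := Aut_closed Aa Tx.
apply: (eq_Aut (A := T)); rewrite ?groupJ ?conj_aut_Aut // => y Ty.
have Ta'y : a^-1 y \in T by rewrite Aut_closed ?groupV.
by rewrite conjgE !permM !conj_autE // aut_conjg // permKV.
Qed.

Lemma order_aut a x : a \in Aut T -> x \in T -> #[a x] = #[x].
Proof. by move=> Aa Tx; rewrite -(autmE Aa) order_injm ?injm_autm. Qed.

Section ClassWidths.
Variables (Y : {set {perm gT}}) (s : gT).
Hypotheses (sYA : Y \subset Aut T) (Y1 : 1 \in Y).
Hypothesis Yinn : forall a y, a \in Y -> y \in T -> a * conj_aut T y \in Y.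
Hypotheses (Ts : s \in T) (nts : s != 1).

Let S := pm_class Y s.

Lemma pm_classP x :
  reflect (exists2 a, a \in Y & x = a s \/ x = (a s)^-1) (x \in S).
Proof.
apply: (iffP setUP) => [[] /imsetP[a Ya ->] | [a Ya [] ->]].
- by exists a; auto.
- by exists a; auto.
- by left; apply: imset_f.
by right; apply/imsetP; exists a.
Qed.

Lemma pm_classV : S^-1 = S.
Proof.
apply/setP=> x; rewrite inE; apply/pm_classP/pm_classP=> [][a Ya def_x]; exists a => //.
  by case: def_x => /(congr1 invg); rewrite ?invgK; auto.
by case: def_x => ->; rewrite ?invgK; auto.
Qed.

Lemma pm_class_sub : S \subset T.
Proof.
by apply/subsetP=> x /pm_classP[a /(subsetP sYA) Aa [] ->]; rewrite ?groupV Aut_closed.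
Qed.

Lemma pm_classJ y : y \in T -> S :^ y = S.
Proof.
have sub z : z \in T -> S :^ z \subset S.
  move=> Tz; apply/subsetP=> _ /imsetP[x /pm_classP[a Ya def_x] ->].
  apply/pm_classP; exists (a * conj_aut T z); first exact: Yinn.
  have Tas : a s \in T by rewrite Aut_closed ?(subsetP sYA).
  by case: def_x => ->; rewrite ?conjVg permM conj_autE //; auto.
move=> Ty; apply/eqP; rewrite eqEsubset sub //=.
by rewrite -sub_conjgV sub ?groupV.
Qed.

(** The generated subgroup is normal in T and contains s. *)
Lemma pm_class_gen : <<S>> = T.
Proof.
have nS : <<S>> <| T.
  rewrite /normal gen_subG pm_class_sub norms_gen //.
  by apply/subsetP=> y Ty; rewrite inE pm_classJ.
have [_ /(_ _ nS)[] // S1] := simpleP _ simT.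
have: s \in <<S>>.
  by apply/mem_gen/pm_classP; exists 1; rewrite ?perm1; auto.
by rewrite S1 => /set1P/eqP; rewrite (negbTE nts).
Qed.

Lemma order_pm_class x : x \in S -> #[x] = #[s].
Proof.
by case/pm_classP=> a /(subsetP sYA) Aa [] ->; rewrite ?orderV order_aut.
Qed.

(** Width at most 1 would give all nontrivial elements of T the order of s.  By
    Cauchy's theorem the only prime divisor of the order of T would then be that
    order, so T would be a p-group, hence solvable. *)
Lemma class_width_gt1 : 1 < class_width T Y s.
Proof.
rewrite ltnNge; apply/negP=> le_w1.
have ordT x : x \in T -> x != 1 -> #[x] = #[s].
  move=> Tx ntx; have [j le_j] := width_bound pm_class_gen Tx.
  case: j le_j => [_|[_|j /leq_trans/(_ le_w1)//]].
    by rewrite expg0 => /set1P x1; rewrite x1 eqxx in ntx.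
  by rewrite expg1; apply: order_pm_class.
(* The order of s plays the role of the prime p. *)
have pT : #[s].-group T.
  apply/pgroupP=> p p_pr /(Cauchy p_pr)[x Tx ox]; rewrite /= inE -ox.
  by rewrite ordT // -order_gt1 ox prime_gt1.
case/negP: nabT; apply/cyclic_abelian/prime_cyclic/simple_sol_prime => //.
exact: pgroup_sol pT.
Qed.

End ClassWidths.
End SimpleGroups.

(** * Simple diagonal groups *)

Section WreathElements.
Local Open Scope group_scope.
Variables (k : nat) (A : finGroupType).
Implicit Types (u v : wreath k A) (a b : A) (i j : 'I_k) (s : 'S_k).

Definition wconst a s : wreath k A := Wreath [ffun=> a] s.
Definition wsingle j a : wreath k A := Wreath [ffun i => if i == j then a else 1] 1.

Lemma eq_wreath u v : wbase u =1 wbase v -> wperm u = wperm v -> u = v.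
Proof. by case: u v => [f s] [g r] /= /ffunP-> ->. Qed.

Lemma wbaseM u v i : wbase (u * v) i = wbase u i * wbase v (wperm u i).
Proof. by rewrite /= ffunE. Qed.

Lemma wpermM u v : wperm (u * v) = wperm u * wperm v.
Proof. by []. Qed.

Lemma wbaseV u i : wbase u^-1 i = (wbase u ((wperm u)^-1 i))^-1.
Proof. by rewrite /= ffunE. Qed.

Lemma wpermV u : wperm u^-1 = (wperm u)^-1.
Proof. by []. Qed.

Lemma wbase1 i : wbase (1 : wreath k A) i = 1.
Proof. by rewrite /= ffunE. Qed.

Lemma wconstM a s b r : wconst a s * wconst b r = wconst (a * b) (s * r).
Proof. by apply: eq_wreath => // i; rewrite wbaseM !ffunE. Qed.

Lemma wsingleM j a b : wsingle j a * wsingle j b = wsingle j (a * b).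
Proof.
apply: eq_wreath => [i|]; last by rewrite wpermM mulg1.
by rewrite wbaseM !ffunE /= perm1; case: eqP; rewrite ?mulg1.
Qed.

Lemma wsingleV j a : (wsingle j a)^-1 = wsingle j a^-1.
Proof.
apply: eq_wreath => [i|]; last by rewrite wpermV invg1.
by rewrite wbaseV !ffunE /= invg1 perm1; case: eqP; rewrite ?invg1.
Qed.

(** Conjugation by a diagonal element permutes the coordinates and acts on the
    entries: this is how D moves tau around. *)
Lemma wsingle_conj j b a s : wsingle j b ^ wconst a s = wsingle (s j) (b ^ a).
Proof.
apply: eq_wreath => [i|]; last by rewrite conjgE !wpermM wpermV mul1g mulVg.
rewrite conjgE !wbaseM wbaseV wpermV !ffunE /=.
rewrite (canF_eq (permKV s)) conjgE.
by case: eqP; rewrite ?mul1g ?mulVg.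
Qed.

Lemma prod_wsingle (a : 'I_k -> A) :
  \prod_i wsingle i (a i) = Wreath [ffun i => a i] 1.
Proof.
suff E r : uniq r ->
    \prod_(i <- r) wsingle i (a i) = Wreath [ffun i => if i \in r then a i else 1] 1.
  rewrite E ?index_enum_uniq //; apply: eq_wreath => // i.
  by rewrite !ffunE mem_index_enum.
elim: r => [|j r IH] /= => [_|/andP[r'j Ur]].
  by rewrite big_nil; apply: eq_wreath => // i; rewrite wbase1 ffunE.
rewrite big_cons IH //; apply: eq_wreath => [i|]; last by rewrite wpermM mulg1.
rewrite wbaseM !ffunE perm1 inE; case: eqP => [->|_] /=; last by rewrite mul1g.
by rewrite (negPf r'j) mulg1.
Qed.

End WreathElements.

Section DiagonalGroup.
Local Open Scope group_scope.
Variables (gT : finGroupType) (T : {group gT}) (k : nat).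
Variables (X : {group coset_of (Inn T) * 'S_k}) (l : 'I_k).
Implicit Types (u w : wreath k {perm gT}) (a : {perm gT}) (s : 'S_k).

Local Notation G := (diag_ext_group X).

Lemma diag_extP w :
  reflect [/\ forall i, wbase w i \in Aut T,
              forall i j, wbase w i * (wbase w j)^-1 \in Inn T
            & forall i, (coset (Inn T) (wbase w i), wperm w) \in X]
          (w \in G).
Proof.
rewrite !inE; apply: (iffP andP) => [[/andP[/forallP A /forallP C] /forallP Y]|[A C Y]].
  split=> // i j; rewrite -mem_rcoset; apply/rcoset_eqP/eqP.
  by have /forallP := C i; apply.
split; last exact/forallP.
apply/andP; split; first exact/forallP.
apply/forallP=> i; apply/forallP=> j; apply/eqP/rcoset_eqP.
by rewrite mem_rcoset.
Qed.

(** The condition on X is read off from the entry at the coordinate l. *)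
Lemma diag_stabP w :
  reflect (exists a s, [/\ a \in Aut T, (coset (Inn T) a, s) \in X & w = wconst a s])
          (w \in diag_stab X).
Proof.
apply: (iffP setIP) => [[] | [a [s [Aa Xas ->]]]].
  rewrite inE => /exists_inP[a Aa /eqP def_w] /diag_extP[_ _ /(_ l)].
  rewrite def_w ffunE => Xw; exists a, (wperm w); split=> //.
  by apply: eq_wreath => // i; rewrite def_w.
split; first by rewrite inE; apply/exists_inP; exists a.
by apply/diag_extP; split=> [i|i j|i]; rewrite /= !ffunE ?mulgV ?group1.
Qed.

Lemma diag_stab_group_set : group_set (diag_stab X).
Proof.
have nIA := subsetP (normal_norm (Inn_normal T)).
apply/group_setP; split.
  rewrite inE (group1 G) andbT inE; apply/exists_inP; exists 1; rewrite ?group1 //.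
move=> u w /diag_stabP[a [s [Aa Xas ->]]] /diag_stabP[b [r [Ab Xbr ->]]].
apply/diag_stabP; exists (a * b), (s * r); split; last exact: wconstM.
  exact: groupM.
by rewrite morphM ?nIA //; apply: (groupM Xas Xbr).
Qed.

Definition diag_stab_group := Group diag_stab_group_set.
Local Notation D := diag_stab_group.

Lemma diag_stab_sub : D \subset G.
Proof. exact: subsetIr. Qed.

(** Elements of G induce on the coordinates only permutations that D induces. *)
Lemma diag_stab_of w i : w \in G -> wconst (wbase w i) (wperm w) \in D.
Proof.
case/diag_extP=> Aw _ Xw; apply/diag_stabP.
by exists (wbase w i), (wperm w).
Qed.

Lemma inner_diag_ext w :
  (forall i, wbase w i \in Inn T) -> wperm w = 1 -> w \in G.
Proof.
move=> Iw w1; apply/diag_extP; split=> [i|i j|i].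
- exact: (subsetP (Inn_sub_Aut T)).
- by rewrite groupM ?groupV.
by rewrite w1 coset_id ?group1.
Qed.

(** Dividing w on the left by the diagonal element with its permutation and its
    entry at the preimage of i0 makes the entry at i0 trivial; the other entries
    become inner because all entries of w lie in one coset of Inn T. *)
Lemma inner_representative w i0 :
    w \in G ->
  exists2 v, D :* v = D :* w &
    [/\ forall i, wbase v i \in Inn T, wbase v i0 = 1 & wperm v = 1].
Proof.
move=> Gw; set j0 := (wperm w)^-1 i0.
set d := wconst (wbase w j0) (wperm w).
have Dd : d \in D by apply: diag_stab_of.
exists (d^-1 * w); first by rewrite rcosetM rcoset_id ?groupV.
have [Aw Iw _] := diag_extP w Gw.
have base i : wbase (d^-1 * w) i = (wbase w j0)^-1 * wbase w ((wperm w)^-1 i).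
  by rewrite wbaseM wbaseV !ffunE.
split=> [i||]; rewrite ?base ?mulVg //; last by rewrite wpermM wpermV mulVg.
rewrite -(memJ_norm _ (subsetP (normal_norm (Inn_normal T)) _ (groupVr (Aw j0)))).
by rewrite conjgE invgK !mulgA mulgV mul1g.
Qed.

Lemma wsingle_diag_ext j x : x \in T -> wsingle j (conj_aut T x) \in G.
Proof.
move=> Tx; apply: inner_diag_ext => // i; rewrite ffunE.
by case: ifP => _; rewrite ?group1 ?conj_aut_Inn.
Qed.

Lemma primitive_maximal_stab :
  [primitive diag_ext X, on diag_vertices X | 'Rs] -> maximal_eq D G.
Proof.
move=> primG; have vD : diag_stab X \in diag_vertices X.
  by apply/rcosetsP; exists 1; rewrite ?group1 ?mulg1.
have := primG; rewrite (trans_prim_astab vD (proj1 (andP primG))).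
by rewrite (astab1Rs D) (setIidPr diag_stab_sub).
Qed.

(** Coordinates are numbered from 0, so the last one is k - 1. *)
Lemma last_eltE t : l.+1 = k -> last_elt T k t = wsingle l (conj_aut T t).
Proof.
move=> def_l; apply: eq_wreath => // i; rewrite !ffunE.
by rewrite -[X in _ == X]def_l eqSS.
Qed.

Section Steps.
Variable t : gT.
Hypothesis Tt : t \in T.
Let tau : wreath k {perm gT} := wsingle l (conj_aut T t).
Let U := steps D tau.

Lemma step_single u :
    u \in U ->
  exists j y, y \in pm_class (diag_X0 X) t /\ u = wsingle j (conj_aut T y).
Proof.
have X0 a s : a \in Aut T -> (coset (Inn T) a, s) \in X -> a \in diag_X0 X.
  by move=> Aa Xas; rewrite inE Aa; apply/imsetP; exists (coset (Inn T) a, s).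
case/setUP=> /imsetP[d /diag_stabP[a [s [Aa Xas ->]]] ->].
  rewrite wsingle_conj conj_aut_autJ //; exists (s l), (a t); split=> //.
  by apply/pm_classP; exists a; rewrite ?(X0 a s); auto.
rewrite wsingleV wsingle_conj conjVg conj_aut_autJ // -conj_autV ?Aut_closed //.
exists (s l), (a t)^-1; split=> //.
by apply/pm_classP; exists a; rewrite ?(X0 a s); auto.
Qed.

(** Each letter multiplies a single coordinate by an element of the class, so m i
    counts the letters acting at coordinate i. *)
Lemma word_coordinates n z :
    z \in U ^+ n ->
  exists (x : 'I_k -> gT) (m : 'I_k -> nat),
    [/\ forall i, x i \in T, forall i, x i \in pm_class (diag_X0 X) t ^+ m i,
        z = Wreath [ffun i => conj_aut T (x i)] 1 & (\sum_i m i = n)%N].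
Proof.
elim: n z => [|n IH] z.
  rewrite expg0 => /set1P->; exists (fun=> 1), (fun=> 0%N).
  split=> [i|i||]; rewrite ?group1 ?expg0 ?set11 //; last by rewrite big1_eq.
  by apply: eq_wreath => // i; rewrite wbase1 ffunE morph1.
rewrite expgS => /mulsgP[u z' /step_single[j [y [Sy ->]]] /IH[x [m [Tx Sx -> <-]]] ->].
have Ty : y \in T.
  apply: (subsetP (pm_class_sub _ Tt)) Sy.
  by apply/subsetP=> a; rewrite inE => /andP[].
exists (fun i => if i == j then y * x i else x i).
exists (fun i => (i == j) + m i)%N; split=> [i|i||].
- by case: ifP => _; rewrite ?groupM.
- by case: ifP => _ //; rewrite add1n expgS mem_mulg.
- apply: eq_wreath => [i|]; last by rewrite wpermM mulg1.
  by rewrite wbaseM !ffunE perm1; case: eqP => _; rewrite ?mul1g ?conj_autM.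
rewrite big_split /= (bigD1 j) //= eqxx big1 ?addn0 ?add1n // => i.
by move/negPf->.
Qed.

(** The orbit of the last coordinate under D, or equivalently under G. *)
Definition reachable := [set wperm d l | d in D].

(** If (a, ..., a).s carries the last coordinate to j, then so does its product with
    any inner diagonal element, so the whole T-class of a t and of its inverse is
    available at j. *)
Lemma reachable_steps j :
    j \in reachable -> t != 1 ->
  exists2 y, y \in T^# &
    forall n x, x \in pm_class (Inn T) y ^+ n -> wsingle j (conj_aut T x) \in U ^+ n.
Proof.
case/imsetP=> _ /diag_stabP[a [s [Aa Xas ->]]] /= -> nt_t.
have Tat : a t \in T by apply: Aut_closed.
have sIA := Inn_sub_Aut T.
exists (a t); first by rewrite !inE Tat -order_eq1 (order_aut Aa Tt) order_eq1 nt_t.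
have step b : b \in Inn T -> wconst (a * b) s \in D.
  move=> Ib; apply/diag_stabP; exists (a * b), s.
  have Ab := subsetP sIA b Ib; split; rewrite ?groupM //.
  by rewrite coset_kerr.
have step1 x : x \in pm_class (Inn T) (a t) -> wsingle (s l) (conj_aut T x) \in U.
  case/pm_classP=> b Ib; have Ab := subsetP sIA b Ib; have Dd := step b Ib.
  rewrite -permM; case=> ->; rewrite ?conj_autV ?Aut_closed ?groupM // -conj_aut_autJ ?groupM //.
    by rewrite -wsingle_conj inE memJ_class.
  by rewrite -conjVg -wsingle_conj -wsingleV inE orbC memJ_class.
elim=> [|n IH] x.
  rewrite !expg0 => /set1P->; rewrite morph1; apply/set1P.
  by apply: eq_wreath => // i; rewrite wbase1 ffunE; case: ifP.
rewrite !expgS => /mulsgP[y z Sy Sz ->].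
have sST := subsetP (pm_class_sub sIA Tat).
have Tz : z \in T.
  elim: {IH} n z Sz => [|n IH] z; first by rewrite expg0 => /set1P->.
  by rewrite expgS => /mulsgP[y' z' /sST Ty' /IH Tz' ->]; rewrite groupM.
have Ty := sST y Sy.
by rewrite (conj_autM Ty Tz) -wsingleM mem_mulg ?step1 ?IH.
Qed.

(** The elements of G whose entries agree at all unreachable coordinates form a
    subgroup containing D.  It contains tau, which is not in D, and if i and j were
    distinct it would miss the element with the single entry t at i. *)
Lemma unreachable_unique i j :
    simple T -> ~~ abelian T -> t != 1 -> maximal_eq D G ->
    i \notin reachable -> j \notin reachable -> i = j.
Proof.
move=> simT nabT nt_t maxD Ri Rj.
have [// | neq_ij] := eqVneq i j.
have nt_ct : conj_aut T t != 1.
  by rewrite -(morph1 (conj_aut T)) (inj_in_eq (conj_aut_inj simT nabT)) ?group1.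
pose K := [set w in G | [forall i', forall j',
  (i' \notin reachable) ==> (j' \notin reachable) ==> (wbase w i' == wbase w j')]].
have KP w : reflect (w \in G /\ forall i' j', i' \notin reachable -> j' \notin reachable ->
    wbase w i' = wbase w j') (w \in K).
  apply: (iffP setIdP) => [[Gw /forallP H]|[Gw H]]; split=> //.
    move=> i' j' Ri' Rj'; have /forallP/(_ j') := H i'.
    by rewrite Ri' Rj' => /eqP.
  apply/forallP=> i'; apply/forallP=> j'; apply/implyP=> Ri'; apply/implyP=> Rj'.
  exact/eqP/H.
have permR w i' : w \in G -> i' \notin reachable -> wperm w i' \notin reachable.
  move=> Gw; apply: contra => /imsetP[d Dd def_d].
  apply/imsetP; exists (d * (wconst (wbase w l) (wperm w))^-1).
    by rewrite groupM ?groupV ?diag_stab_of.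
  by rewrite wpermM wpermV permM -def_d permK.
have gK : group_set K.
  apply/group_setP; split.
    by apply/KP; split=> [|i' j' _ _]; rewrite ?group1 ?wbase1.
  move=> u w /KP[Gu Ku] /KP[Gw Kw]; apply/KP; split=> [|i' j' Ri' Rj']; first exact: groupM.
  by rewrite !wbaseM (Ku i' j') // (Kw _ (wperm u j')) ?permR.
have [_ /(_ (Group gK))[]] := maximal_eqP _ _ maxD.
- apply/subsetP=> d Dd; apply/KP; split; first exact: (subsetP diag_stab_sub).
  by move=> i' j' _ _; have [a [s [_ _ ->]]] := diag_stabP _ Dd; rewrite !ffunE.
- by apply/subsetP=> w /KP[].
- move=> /= KD; have: tau \in K.
    have Rl i' : i' \notin reachable -> (i' == l) = false.
      move=> Ri'; apply: contraNF Ri' => /eqP->; apply/imsetP; exists 1; rewrite ?group1 //=.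
      by rewrite perm1.
    by apply/KP; split=> [|i' j' Ri' Rj']; rewrite ?wsingle_diag_ext // !ffunE !Rl.
  rewrite KD => /diag_stabP[a [s [_ _ /(congr1 (@wbase _ _)) /ffunP eq_a]]].
  have [j' ne_j'] : exists j', j' != l.
    by have [<-|] := eqVneq i l; [exists j; rewrite eq_sym | exists i].
  case/negP: nt_ct; have := eq_a l; have := eq_a j'.
  by rewrite !ffunE eqxx (negPf ne_j') => <- ->.
move=> /= KG; have: wsingle i (conj_aut T t) \in K by rewrite KG wsingle_diag_ext.
case/KP=> _ /(_ i j Ri Rj); rewrite !ffunE eqxx eq_sym (negPf neq_ij) => ct1.
by case/eqP: nt_ct.
Qed.

End Steps.
End DiagonalGroup.

(** * The two bounds *)

Lemma sum_pairs k m c (f : 'I_k -> nat) (le_2m : m + m <= k) :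
    (forall i j : 'I_k, i < m -> j = (m + i)%N :> nat -> c <= f i + f j) ->
  m * c + \sum_(i < k | m + m <= i) f i <= \sum_i f i.
Proof.
rewrite -(subnKC le_2m) in f *; move: (k - _) f => r f pairs.
rewrite [X in _ + X <= _]big_split_ord [X in _ <= X]big_split_ord /= big_pred0 => [|i]; last first.
  by rewrite leqNgt ltn_ord.
rewrite add0n leq_add //; last first.
  by apply: eq_leq; apply: eq_bigl => i; rewrite leq_addr.
rewrite [X in _ <= X]big_split_ord /= -big_split /= -[X in X * c]card_ord -sum_nat_const.
by apply: leq_sum => i _; apply: pairs => /=.
Qed.

(** For even k the pairs account for the whole sum, which is at least k c / 2, and
    c >= 2 provides the surplus.  For odd k one index z is left over: either f z
    contributes the missing 1, or f z = 0 and every pair exceeds c. *)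
Lemma sum_half_pairs k c (f : 'I_k -> nat) :
    1 < k -> 1 < c ->
    (forall i j : 'I_k, i < k./2 -> j = (k./2 + i)%N :> nat -> c <= f i + f j) ->
    (forall z i j : 'I_k, z = (k./2 + k./2)%N :> nat -> f z = 0 ->
       i < k./2 -> j = (k./2 + i)%N :> nat -> c < f i + f j) ->
  (k - 1) * c + 2 <= 2 * \sum_i f i.
Proof.
move=> k_gt1 c_gt1; have def_k : k = (odd k + (k./2 + k./2))%N.
  by rewrite addnn odd_double_half.
move: k_gt1 def_k; set m := k./2 => k_gt1 def_k pairs pairs0.
have le_2m : m + m <= k by rewrite def_k leq_addl.
have le_sum := sum_pairs le_2m pairs.
case odd_k: (odd k) def_k => def_k.
  have lt_z : m + m < k by rewrite def_k.
  pose z := Ordinal lt_z; have [f0 | f_gt0] := posnP (f z).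
    have := sum_pairs le_2m (fun i j => pairs0 z i j erefl f0).
    move: {le_sum pairs pairs0 z f0} k_gt1 def_k.
    by move: (\sum_(i < k | _) _) (\sum_i _)=> s1 s2; clear -c_gt1; nia.
  have : f z <= \sum_(i < k | m + m <= i) f i by rewrite (bigD1 z) //= leq_addr.
  move: {pairs pairs0} f_gt0 le_sum k_gt1 def_k; move: (f z) => fz.
  by move: (\sum_(i < k | _) _) (\sum_i _) => s1 s2; clear -c_gt1; nia.
move: {pairs pairs0} le_sum k_gt1 def_k.
by move: (\sum_(i < k | _) _) (\sum_i _) => s1 s2; clear -c_gt1; nia.
Qed.

Lemma rat_half_bound (k c d : nat) :
  0 < k -> (k - 1) * c + 2 <= 2 * d ->
  (2^-1 * (k%:R - 1) * c%:R + 1 <= d%:R :> rat)%R.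
Proof.
move=> k_gt0; rewrite -(ler_nat rat) natrD !natrM natrB //.
lra.
Qed.

Section DiameterBounds.
Local Open Scope group_scope.
Variables (gT : finGroupType) (T : {group gT}) (k : nat).
Variables (X : {group coset_of (Inn T) * 'S_k}) (l : 'I_k) (t : gT).
Hypotheses (simT : simple T) (nabT : ~~ abelian T).
Hypotheses (Tt : t \in T) (nt_t : t != 1).

Local Notation G := (diag_ext_group X).
Local Notation D := (diag_stab_group X l).
Local Notation U := (steps D (wsingle l (conj_aut T t))).

Lemma inner_class_width_le s :
  s \in T^# -> class_width T (Inn T) s <= inner_width T.
Proof. by move=> Ts; apply: (leq_bigmax_cond (F := class_width T (Inn T))). Qed.

(** One coordinate is made trivial, and it is chosen so that all others are
    reachable; each of these k - 1 entries is then a word in a class available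
    there, of length at most the inner width. *)
Lemma word_length_upper_bound w :
    maximal_eq D G -> w \in G ->
  exists n z, [/\ n <= (k - 1) * inner_width T, z \in U ^+ n & D :* z = D :* w].
Proof.
move=> maxD Gw.
have [i0 reach_i0] : exists i0, forall j, j != i0 -> j \in reachable X l.
  case: (pickP [pred i | i \notin reachable X l]) => [i0 /= Ri0 | all_reach].
    exists i0 => j; apply: contraR => Rj; apply/eqP.
    exact: (unreachable_unique Tt simT nabT nt_t maxD).
  by exists l => j _; have /negbFE := all_reach j.
have [v <- [Iv v0 v1]] := inner_representative l i0 Gw.
have coord j : exists n, (n <= (j != i0) * inner_width T) &&
    (wsingle j (wbase v j) \in U ^+ n).
  have [-> | ne_j] := eqVneq j i0.
    exists 0%N; rewrite v0 expg0 /=; apply/set1P.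
    by apply: eq_wreath => // i; rewrite wbase1 ffunE; case: ifP.
  have [y Ty Uy] := reachable_steps Tt (reach_i0 j ne_j) nt_t.
  have /InnP[x Tx ->] := Iv j.
  have /setD1P[nty Ty'] := Ty.
  have gen_y : <<pm_class (Inn T) y>> = T.
    apply: pm_class_gen; rewrite ?Inn_sub_Aut ?group1 // => a z Ia Tz.
    by rewrite groupM ?conj_aut_Inn.
  have [n le_n Sx] := width_bound gen_y Tx.
  exists n; rewrite Uy // andbT mul1n (leq_trans le_n) //.
  exact: inner_class_width_le.
have [n_ nP] := fin_all_exists coord.
exists (\sum_j n_ j)%N, (\prod_j wsingle j (wbase v j)); split.
- apply: leq_trans (_ : \sum_j (j != i0) * inner_width T <= _)%N.
    by apply: leq_sum => j _; have /andP[] := nP j.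
  rewrite -big_distrl /= leq_mul2r; apply/orP; right.
  rewrite (bigD1 i0) //= eqxx add0n (eq_bigr (fun=> 1%N)) => [|j ->] //.
  by rewrite sum1_card cardC1 card_ord subn1.
- elim/big_rec2: _ => [|j n z _ Uz]; first by rewrite expg0 set11.
  by rewrite expgD mem_mulg //; have /andP[] := nP j.
congr (_ :* _); rewrite prod_wsingle; apply: eq_wreath => // i.
by rewrite ffunE.
Qed.

Let S := pm_class (diag_X0 X) t.
Let c := class_width T (diag_X0 X) t.

Lemma diag_X0_sub : diag_X0 X \subset Aut T.
Proof. by apply/subsetP=> a; rewrite inE => /andP[]. Qed.

Lemma diag_X0_inner a y : a \in diag_X0 X -> y \in T -> a * conj_aut T y \in diag_X0 X.
Proof.
case/setIdP=> Aa Xa Ty; apply/setIdP; rewrite groupM ?conj_aut_Aut //.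
by rewrite coset_kerr ?conj_aut_Inn.
Qed.

Lemma diag_X0_1 : 1 \in diag_X0 X.
Proof.
apply/setIdP; rewrite group1 morph1; split=> //.
by apply/imsetP; exists 1; rewrite ?group1.
Qed.

(** The remote vertex has the entries (1, ..., 1, g, ..., g), followed for odd k by a
    conjugate h of g different from g, where g is an element of maximal length. *)
Lemma word_length_lower_bound :
    1 < k ->
  exists2 w, w \in G &
    forall n z, z \in U ^+ n -> D :* z = D :* w -> (k - 1) * c + 2 <= 2 * n.
Proof.
move=> k_gt1.
have genS : <<S>> = T := pm_class_gen simT diag_X0_sub diag_X0_1 diag_X0_inner Tt nt_t.
have SV : S^-1 = S := pm_classV _ _.
have SJ y : y \in T -> S :^ y = S by apply: (pm_classJ diag_X0_sub diag_X0_inner Tt).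
have c_gt1 : 1 < c := class_width_gt1 simT nabT diag_X0_sub diag_X0_1 diag_X0_inner Tt nt_t.
have [g Tg len_g] := width_attained genS (ltnW c_gt1).
have nt_g : g != 1.
  apply/eqP=> g1; have: g \in S ^+ 0 by rewrite g1 expg0 set11.
  by move/len_g/(leq_trans c_gt1).
have [y Ty gy_ne] := moved_by_conj simT nabT Tg nt_g.
pose h := g ^ y.
have Th : h \in T by rewrite groupJ.
have len_h j : h \in S ^+ j -> c <= j.
  move=> Sh; apply: len_g; rewrite -[g](conjgK y) -/h.
  by apply: mem_expgJ; rewrite ?SJ ?groupV.
pose m := k./2.
pose e (i : 'I_k) := if i < m then 1 else if i < m + m then g else h.
have Te i : e i \in T by rewrite /e; case: ifP => _; last case: ifP.
exists (Wreath [ffun i => conj_aut T (e i)] 1).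
  by apply: inner_diag_ext => // i; rewrite ffunE conj_aut_Inn.
move=> n z Uz eqD.
have [x [f [Tx Sx def_z <-]]] := word_coordinates Tt Uz.
have ratio i j : (x i)^-1 * x j = (e i)^-1 * e j.
  have: z * (Wreath [ffun i => conj_aut T (e i)] 1)^-1 \in D.
    by rewrite -mem_rcoset; apply/rcoset_eqP.
  case/(diag_stabP _ l)=> a [s [_ _ /(congr1 (@wbase _ _))/ffunP eq_a]].
  (* z and the chosen element differ by an element of D, whose entries all agree. *)
  have q i' : x i' * (e i')^-1 = x i * (e i)^-1.
    apply: (conj_aut_inj simT nabT); rewrite ?groupM ?groupV //.
    rewrite !conj_autM ?groupV // !conj_autV //.
    have := eq_a i'; have := eq_a i; rewrite !wbaseM !wbaseV def_z.
    by rewrite !ffunE /= !invg1 !perm1 => -> ->.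
  by rewrite -(mulgKV (e j) (x j)) q !mulgA mulVg mul1g.
have dist i j : (e i)^-1 * e j \in S ^+ (f i + f j).
  rewrite -ratio expgD; apply: mem_mulg; last exact: Sx.
  by apply: mem_expgV => //; apply: Sx.
have pair_e (i j : 'I_k) : i < m -> j = (m + i)%N :> nat -> e i = 1 /\ e j = g.
  move=> lt_i def_j; rewrite /e lt_i def_j ltn_add2l lt_i.
  by rewrite ltnNge leq_addr.
apply: sum_half_pairs => // [i j | z0 i j def_z0 f0] lt_i def_j;
  have [ei ej] := pair_e i j lt_i def_j.
  by apply: len_g; have := dist i j; rewrite ei ej invg1 mul1g.
have ez0 : e z0 = h by rewrite /e def_z0 -/m !ltnNge leq_addr leqnn.
(* Since x z0 = 1, the length of e i is measured from h: it is length(h) >= c for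
   e i = 1, and positive for e j = g. *)
have le_c : c <= f i.
  have := dist z0 i; rewrite f0 ez0 ei mulg1 add0n => /(mem_expgV SV).
  by rewrite invgK => /len_h.
suff f_gt0 : 0 < f j by rewrite -addn1 leq_add.
rewrite lt0n; apply/eqP=> fj0; have := dist z0 j.
rewrite f0 fj0 ez0 ej expg0 => /set1P/(canRL (mulKVg _)).
by rewrite mulg1 => gh; rewrite -/h gh eqxx in gy_ne.
Qed.

End DiameterBounds.

Theorem mainTheorem1 (gT : finGroupType) (T : {group gT}) (k : nat)
    (X : {group coset_of (Inn T) * 'S_k}) (t : gT) :
  simple T -> ~~ abelian T ->
  1 < k ->
  X \subset setX (Out T) [set: 'S_k] ->
  [primitive diag_ext X, on diag_vertices X | 'Rs] ->
  t \in T^#%g ->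
  exists d : nat,
    is_diameter (diag_vertices X) (orbital_adj X t) d /\
    (2^-1 * (k%:R - 1) * (class_width T (diag_X0 X) t)%:R + 1 <= d%:R :> rat)%R /\
    d <= (k - 1) * inner_width T.
Proof.
move=> simT nabT k_gt1 _ primG /setD1P[nt_t Tt].
have lt_l : k.-1 < k by rewrite prednK // ltnW.
pose l := Ordinal lt_l; have def_l : l.+1 = k by rewrite /= prednK // ltnW.
have maxD := primitive_maximal_stab l primG.
set c := class_width _ _ _; pose tau := wsingle l (conj_aut T t).
have -> : orbital_adj X t = coset_adj (diag_stab_group X l) (diag_ext_group X) tau.
  by rewrite /orbital_adj (last_eltE _ _ def_l).
have sDG := diag_stab_sub X l.
have Gtau : tau \in diag_ext_group X := wsingle_diag_ext X l Tt.
have [d diam_d le_d] :=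
  coset_diameter_le sDG Gtau (fun w => word_length_upper_bound simT nabT Tt nt_t maxD (w := w)).
have [w Gw far_w] := word_length_lower_bound X l simT nabT Tt nt_t k_gt1.
have [n [z [le_n Uz eqD]]] := coset_word_le_diameter sDG Gtau diam_d Gw.
exists d; split=> //; split=> //.
apply: rat_half_bound; first exact: ltnW.
by apply: leq_trans (far_w _ _ Uz eqD) _; rewrite leq_mul2l.
Qed.
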